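(* Let $\mathcal D_0$ be an ordered, oriented Descartes configuration. Let $\Sigma$ be the set of points of $\hat{\mathbb C}$ lying on at least two distinct circles that occur in configurations of the orbit $\mathcal A^\perp(\mathcal D_0)=\{\mathcal D:\mathbf W_{\mathcal D}=\mathbf U\mathbf W_{\mathcal D_0},\ \mathbf U\in\mathcal A^\perp\}$. Let $\mathcal D_0^\perp$ be the ordered, oriented Descartes configuration with $\mathbf W_{\mathcal D_0^\perp}=\mathbf D\mathbf W_{\mathcal D_0}$. Then the closure $\overline{\Sigma}$ equals the residual set $\Lambda(\mathcal P_{\mathcal D_0^\perp})$ of the Apollonian packing generated by $\mathcal D_0^\perp$.
   Context: Oriented circles/lines and oriented Descartes configurations: four mutually tangent oriented circles/lines with six distinct tangency points whose interiors are pairwise disjoint or become so after reversing all orientations. Augmented curvature-center coordinates: for center $\mathbf c$, oriented radius $r$: $\mathbf w(C)=((|\mathbf c|^2-r^2)/r,1/r,c_1/r,c_2/r)$; for the line $\mathbf x\cdot\mathbf h=m$ with interior-pointing unit normal $\mathbf h$: $(2m,0,h_1,h_2)$; $\mathbf W_{\mathcal D}$ has rows $\mathbf w(C_k)$; $\mathcal D\mapsto\mathbf W_{\mathcal D}$ is a bijection onto $\{\mathbf W:\mathbf W^T\mathbf Q_D\mathbf W=\mathbf Q_W\}$ ($\mathbf Q_D=\mathbf I-\frac12\mathbf 1\mathbf 1^T$, $\mathbf Q_W=\begin{pmatrix}0&-4&0&0\\-4&0&0&0\\0&0&2&0\\0&0&0&2\end{pmatrix}$). $\mathcal A^\perp=\langle\mathbf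 S_1^\perp,\dots,\mathbf S_4^\perp\rangle$, where $\mathbf S_i^\perp$ agrees with the identity except in column $i$, which has $-1$ in position $i$ and $2$ elsewhere. $\mathbf D=\tfrac12(\mathbf 1\mathbf 1^T)-2\cdot\tfrac12\mathbf I$, i.e. diagonal entries $-1/2$, off-diagonal $1/2$. Apollonian packing $\mathcal P_{\mathcal D}$: the set of all circles occurring in Descartes configurations obtained from $\mathcal D$ by finitely many replacements of one circle $C_i$ by the unique other circle tangent to the remaining three at new points. Residual set $\Lambda(\mathcal P)$: the closure in $\hat{\mathbb C}$ of the union of all circles of $\mathcal P$. *)

(* Defs.v *)
From HB Require Import structures.
From mathcomp Require Import all_boot all_order all_algebra.
From mathcomp Require Import reals.
Set Implicit Arguments. Unset Strict Implicit. Unset Printing Implicit Defensive.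
Import Order.TTheory GRing.Theory Num.Theory.
Local Open Scope ring_scope.

(* Ordered, oriented Descartes configurations are represented by their
   augmented curvature-center coordinate matrices W (rows w(C_1..C_4)),
   using the bijection D |-> W_D onto {W : W^T Q_D W = Q_W}. *)

Section Defs.
Variable R : realType.

Definition QD : 'M[R]_4 := \matrix_(i, j) ((i == j)%:R - 2^-1).
Definition QW : 'M[R]_4 := \matrix_(i, j)
  (if (val i == 0%N) && (val j == 1%N) then -4
   else if (val i == 1%N) && (val j == 0%N) then -4
   else if (i == j) && (1 < val i)%N then 2 else 0).

Definition is_descartes (W : 'M[R]_4) : Prop := W^T *m QD *m W = QW.

Definition Sperp (i : 'I_4) : 'M[R]_4 := \matrix_(j, k)
  (if k == i then (if j == i then -1 else 2) else (j == k)%:R).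

Inductive in_Aperp : 'M[R]_4 -> Prop :=
| Aperp_one : in_Aperp 1%:M
| Aperp_mul (i : 'I_4) U : in_Aperp U -> in_Aperp (Sperp i *m U)
| Aperp_mulV (i : 'I_4) U : in_Aperp U -> in_Aperp (invmx (Sperp i) *m U).

Definition Dmat : 'M[R]_4 := \matrix_(i, j) (if i == j then - 2^-1 else 2^-1).

(* the Riemann sphere: None is the point at infinity *)
Definition hpoint := option (R * R).

(* point set of the oriented circle/line with coordinates w = (bbar, b, b x1, b x2) *)
Definition on_circle (w : 'rV[R]_4) (p : hpoint) : Prop :=
  let b := w 0 1 in
  match p with
  | None => b = 0
  | Some (x, y) =>
      if b != 0 then
        (x - w 0 2 / b) ^+ 2 + (y - w 0 3 / b) ^+ 2 = (b^-1) ^+ 2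
      else x * w 0 2 + y * w 0 3 = w 0 0 / 2
  end.

Definition hclosure (S : hpoint -> Prop) : hpoint -> Prop := fun p =>
  match p with
  | Some (x, y) => forall e : R, 0 < e -> exists x' y',
      S (Some (x', y')) /\ (x' - x) ^+ 2 + (y' - y) ^+ 2 < e ^+ 2
  | None => forall M : R, S None \/
      exists x' y', S (Some (x', y')) /\ M ^+ 2 < x' ^+ 2 + y' ^+ 2
  end.

(* one replacement move: replace circle i by the other circle tangent to
   the remaining three (the other Descartes configuration sharing rows j <> i) *)
Definition replace_step (W W' : 'M[R]_4) : Prop :=
  is_descartes W' /\ exists i : 'I_4,
    row i W' != row i W /\ forall j : 'I_4, j != i -> row j W' = row j W.

Inductive apollo_reach (W : 'M[R]_4) : 'M[R]_4 -> Prop :=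
| apollo_refl : apollo_reach W W
| apollo_step W1 W2 : apollo_reach W W1 -> replace_step W1 W2 -> apollo_reach W W2.

Definition packing_circle (W : 'M[R]_4) (w : 'rV[R]_4) : Prop :=
  exists W' i, apollo_reach W W' /\ w = row i W'.

Definition residual_set (W : 'M[R]_4) : hpoint -> Prop :=
  hclosure (fun p => exists w, packing_circle W w /\ on_circle w p).

Definition orbit_circle (W0 : 'M[R]_4) (w : 'rV[R]_4) : Prop :=
  exists U i, in_Aperp U /\ w = row i (U *m W0).

Definition Sigma (W0 : 'M[R]_4) : hpoint -> Prop := fun p =>
  exists w1 w2, orbit_circle W0 w1 /\ orbit_circle W0 w2 /\
    on_circle w1 p /\ on_circle w2 p /\ on_circle w1 <> on_circle w2.

End Defs.

(* Main.v *)
(* A circle is a vector w of norm 1 for a Lorentzian form on R^4, a point of the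
   sphere is a null line, and incidence is orthogonality. For a Descartes
   configuration W, a point with null vector m is recorded by b = W m, whose
   i-th entry vanishes iff the point lies on the i-th circle; b is null for Q_D
   and S_i^perp acts on it as inversion in the i-th circle. Since
   D S_i^perp = S_i D, the packing generated by D W0 consists of the
   configurations D U W0 with U in A^perp, and the row l of D W is the circle
   through the tangency points of the circles of W other than the l-th.

   Sigma lies on the packing: moving one of the two circles into W = W0 we have
   b_i = 0. If the other entries are positive, ping-pong on reduced words shows
   that (U b)_j = 0 only if row j of U is +-e_i, i.e. the two circles coincide.
   So another entry of b vanishes and the point is a tangency point of an orbit
   configuration, hence lies on two circles of the dual configuration.

   Density: let p lie on row l of D W, i.e. 2 b_l = sum b. The squared distance
   from p to the tangency point of circles i and j is a constant multiple of
   (b_i + b_j) / (c_i + c_j), where c represents the point at infinity. If this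
   stayed above some e along the orbit, the invariance of the pairing of b and c
   would bound |b_i| away from 0 for i <> l; inverting in a circle with b_i < 0
   would then decrease sum b >= 0 by a fixed amount forever. *)
Require Import Defs.
From HB Require Import structures.
From mathcomp Require Import all_boot all_order all_algebra.
From mathcomp Require Import boolp reals.
From mathcomp Require Import ring lra.
Set Implicit Arguments. Unset Strict Implicit. Unset Printing Implicit Defensive.
Import Order.TTheory GRing.Theory Num.Theory.
Local Open Scope ring_scope.

(** * Sums and cases over four indices *)

Lemma sum4 (V : nmodType) (f : 'I_4 -> V) :
  \sum_k f k = f 0 + f 1 + f 2 + f 3.
Proof.
rewrite !big_ord_recl big_ord0 addr0 !addrA.
by congr (f _ + f _ + f _ + f _); apply: val_inj.
Qed.

Lemma ord4P (P : 'I_4 -> Prop) : P 0 -> P 1 -> P 2 -> P 3 -> forall i, P i.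
Proof.
move=> P0 P1 P2 P3 [[|[|[|[|//]]]] lt_i].
- by rewrite (_ : Ordinal _ = 0) //; apply: val_inj.
- by rewrite (_ : Ordinal _ = 1) //; apply: val_inj.
- by rewrite (_ : Ordinal _ = 2) //; apply: val_inj.
- by rewrite (_ : Ordinal _ = 3) //; apply: val_inj.
Qed.

Section ApollonianDuality.
Variable R : realType.
Implicit Types (W : 'M[R]_4) (u v w : 'rV[R]_4) (b c : 'cV[R]_4) (p : hpoint R).

(** * The two forms and the group [in_Aperp] *)

(* For this form circles have norm 1 and externally tangent circles product -1. *)
Definition bform u v : R :=
  u 0 2 * v 0 2 + u 0 3 * v 0 3 - (u 0 0 * v 0 1 + u 0 1 * v 0 0) / 2.

Definition qform b c : R :=
  \sum_i b i 0 * c i 0 - (\sum_i b i 0) * (\sum_i c i 0) / 2.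

Lemma QD_mul : QD R *m QD R = 1%:M.
Proof.
apply/matrixP=> i j; rewrite !mxE sum4 !mxE; move: i j.
by apply: ord4P; apply: ord4P => /=; field.
Qed.

Definition QI : 'M[R]_4 := \matrix_(i, j)
  (if (val i == 0%N) && (val j == 1%N) then - 2^-1
   else if (val i == 1%N) && (val j == 0%N) then - 2^-1
   else if (i == j) && (1 < val i)%N then 1 else 0).

Lemma QW_QI : QW R *m QI = 2%:M.
Proof.
apply/matrixP=> i j; rewrite !mxE sum4 !mxE; move: i j.
by apply: ord4P; apply: ord4P => /=; field.
Qed.

Lemma bformE u v : bform u v = (u *m QI *m v^T) 0 0.
Proof. by rewrite !mxE sum4 !mxE !sum4 !mxE /bform /=; field. Qed.

Lemma qformE b c : qform b c = (b^T *m QD R *m c) 0 0.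
Proof. by rewrite !mxE /qform !sum4 !mxE !sum4 !mxE /=; field. Qed.

(** Naming the two remaining indices lets later arguments treat all pairs at once. *)
Lemma ord4_split (i l : 'I_4) : i != l -> exists j k,
  [/\ [/\ i != j, i != k & j != k], [/\ j != l & k != l] &
      forall f : 'I_4 -> R, \sum_m f m = f i + f j + f k + f l].
Proof.
have S f := sum4 (f : 'I_4 -> R).
move: i l; apply: ord4P; apply: ord4P => // _.
- by exists 2, 3; split=> // f; rewrite S; ring.
- by exists 1, 3; split=> // f; rewrite S; ring.
- by exists 1, 2; split=> // f; rewrite S; ring.
- by exists 2, 3; split=> // f; rewrite S; ring.
- by exists 0, 3; split=> // f; rewrite S; ring.
- by exists 0, 2; split=> // f; rewrite S; ring.
- by exists 1, 3; split=> // f; rewrite S; ring.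
- by exists 0, 3; split=> // f; rewrite S; ring.
- by exists 0, 1; split=> // f; rewrite S; ring.
- by exists 1, 2; split=> // f; rewrite S; ring.
- by exists 0, 2; split=> // f; rewrite S; ring.
- by exists 0, 1; split=> // f; rewrite S; ring.
Qed.

Lemma ord4_neq (i : 'I_4) : exists j, i != j.
Proof. by move: i; apply: ord4P; [exists 1 | exists 0 | exists 0 | exists 0]. Qed.

Lemma SperpE n i (A : 'M[R]_(4, n)) k j :
  (Sperp R i *m A) k j = if k == i then - A i j else A k j + 2 * A i j.
Proof.
rewrite mxE sum4 !mxE; move: i k.
by apply: ord4P; apply: ord4P => /=; ring.
Qed.

Lemma Sperp_sq i : Sperp R i *m Sperp R i = 1%:M.
Proof.
apply/matrixP=> k j; rewrite SperpE !mxE; move: i k j.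
by apply: ord4P; apply: ord4P; apply: ord4P => /=; ring.
Qed.

Lemma SperpK n i : cancel (mulmx (Sperp R i) : 'M_(4, n) -> 'M_(4, n)) (mulmx (Sperp R i)).
Proof. by move=> A; rewrite mulmxA Sperp_sq mul1mx. Qed.

Lemma invmx_Sperp i : invmx (Sperp R i) = Sperp R i.
Proof.
have [u _] := mulmx1_unit (Sperp_sq i).
by rewrite -[LHS]mulmx1 -(Sperp_sq i) mulKmx.
Qed.

Lemma in_Aperp_gen_ind (P : 'M[R]_4 -> Prop) : P 1%:M ->
  (forall i U, in_Aperp U -> P U -> P (Sperp R i *m U)) ->
  forall U, in_Aperp U -> P U.
Proof.
move=> P1 PS U; elim=> [//|i V HV PV|i V HV PV]; first exact: PS HV PV.
by rewrite invmx_Sperp; exact: PS HV PV.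
Qed.

Lemma in_AperpM (U V : 'M[R]_4) : in_Aperp U -> in_Aperp V -> in_Aperp (U *m V).
Proof.
move=> HU HV; move: U HU; apply: in_Aperp_gen_ind; first by rewrite mul1mx.
by move=> i U _ HUV; rewrite -mulmxA; constructor.
Qed.

Lemma in_Aperp_Sperp i : in_Aperp (Sperp R i).
Proof. by rewrite -[Sperp R i]mulmx1; do 2!constructor. Qed.

Lemma in_AperpV (U : 'M[R]_4) : in_Aperp U -> exists2 V, in_Aperp V & V *m U = 1%:M.
Proof.
move: U; apply: in_Aperp_gen_ind; first by exists 1%:M; [constructor | rewrite mul1mx].
move=> i U _ [V HV VU]; exists (V *m Sperp R i).
  exact: in_AperpM HV (in_Aperp_Sperp i).
by rewrite -mulmxA SperpK.
Qed.

(** For [qform], [Sperp R i] is the reflection in the vector with entry 1 at [i] and -1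
    elsewhere. *)
Lemma qform_Sperp i b c : qform (Sperp R i *m b) (Sperp R i *m c) = qform b c.
Proof.
rewrite /qform !sum4 !SperpE; move: i.
by apply: ord4P => /=; field.
Qed.

Lemma sum_Sperp i b : \sum_k (Sperp R i *m b) k 0 = \sum_k b k 0 + 4 * b i 0.
Proof. by rewrite !sum4 !SperpE; move: i; apply: ord4P => /=; ring. Qed.

(** * Half of the null cone and its invariance *)

Definition cone b := qform b b = 0 /\ 0 <= \sum_i b i 0.

(** By nullity the complementary sums [x + y] and [z + t] have nonnegative product; their total is
    nonnegative, so neither is negative. *)
Lemma null_pair_ge0 (x y z t : R) :
  2 * (x * x + y * y + z * z + t * t) = (x + y + z + t) ^+ 2 ->
  0 <= x + y + z + t -> 0 <= x + y.
Proof.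
move=> q s; have h : (x - y) ^+ 2 + (z - t) ^+ 2 = 2 * (x + y) * (z + t) by nra.
rewrite leNgt; apply/negP=> n; have := sqr_ge0 (x - y); have := sqr_ge0 (z - t).
have : 0 < z + t by lra.
nra.
Qed.

Lemma cone_pair_ge0 b i j : cone b -> i != j -> 0 <= b i 0 + b j 0.
Proof.
move=> [q s] /ord4_split[k [l [_ _ S]]]; move: q s; rewrite /qform !S => q s.
apply: (@null_pair_ge0 _ _ (b k 0) (b l 0)); lra.
Qed.

Lemma cone_Sperp i b : cone b -> cone (Sperp R i *m b).
Proof.
move=> cb; split; first by rewrite qform_Sperp; case: cb.
have [j ij] := ord4_neq i; have [k [l [[ik il kl] [kj lj] S]]] := ord4_split ij.
have := cone_pair_ge0 cb ij; have := cone_pair_ge0 cb ik; have := cone_pair_ge0 cb il.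
case: cb; rewrite sum_Sperp /qform !S => q s p1 p2 p3.
have [|n] := lerP 0 (b i 0); first by lra.
(* Nullity and Cauchy-Schwarz on the other three entries give a quadratic inequality for [b i 0]
   that fails below [- o / 5], where the new sum [5 * b i 0 + o] would be negative. *)
set o := b j 0 + b k 0 + b l 0.
have ho : 3 * (b j 0 ^+ 2 + b k 0 ^+ 2 + b l 0 ^+ 2) >= o ^+ 2.
  by rewrite /o; have := sqr_ge0 (b j 0 - b k 0); have := sqr_ge0 (b j 0 - b l 0);
    have := sqr_ge0 (b k 0 - b l 0); nra.
have h : b i 0 ^+ 2 - 2 * b i 0 * o - o ^+ 2 / 3 <= 0 by rewrite /o in ho *; nra.
rewrite leNgt; apply/negP=> d.
have : 0 < - (b i 0 + o / 5) by rewrite /o in d *; lra.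
have : 0 < o by rewrite /o; lra.
clear -h; move=> o0 d0; nra.
Qed.

Lemma cone_Aperp U b : in_Aperp U -> cone b -> cone (U *m b).
Proof.
move=> HU cb; move: U HU; apply: in_Aperp_gen_ind; first by rewrite mul1mx.
by move=> i U _ IH; rewrite -!mulmxA; apply: cone_Sperp.
Qed.

(** * Descent along orbits *)

(* The right-hand side uses (x + y)(x + z) = x ^ 2; on the left, the fourth
   coordinate is eliminated and x' ^ 2 <= (x' + y')(x' + z') bounds the cross term. *)
Lemma approx_bound (e x y z x' y' z' t' : R) : 0 < e ->
  x * y + y * z + x * z = 0 ->
  2 * (x' * x' + y' * y' + z' * z' + t' * t') = (x' + y' + z' + t') ^+ 2 ->
  0 <= x + y -> 0 <= x + z -> 0 <= x' + y' -> 0 <= x' + z' ->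
  e * (x' + y') <= x + y -> e * (x' + z') <= x + z ->
  e * (x * (y' + z') + y * (x' + z') + z * (x' + y')) <= 4 * x ^+ 2.
Proof.
move=> e0 hb hc xy xz xy' xz' exy exz.
have p : (x + y) * (x + z) = x ^+ 2 by nra.
have p' : x' ^+ 2 <= (x' + y') * (x' + z').
  by have := sqr_ge0 (t' - x' - y' - z'); nra.
have q : (e * x') ^+ 2 <= x ^+ 2.
  rewrite -p; apply: (@le_trans _ _ ((e * (x' + y')) * (e * (x' + z')))); last first.
    by apply: ler_pM => //; apply: mulr_ge0 => //; apply: ltW.
  by have := ler_wpM2l (sqr_ge0 e) p'; nra.
have r : - (e * x' * x) <= x ^+ 2 by have := sqr_ge0 (e * x' + x); nra.
have r1 : e * (x' + y') * (x + z) <= x ^+ 2 by rewrite -p ler_wpM2r.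
have r2 : e * (x' + z') * (x + y) <= x ^+ 2 by rewrite -p mulrC ler_wpM2l.
nra.
Qed.

(** Since [b l 0] is the sum of the other three entries of [b], the entry [c l 0] cancels from the
    pairing and [approx_bound] applies to those three. *)
Lemma cone_approx_bound b c l i (e : R) : cone b -> cone c ->
  2 * b l 0 = \sum_k b k 0 -> 0 < e ->
  (forall j k, j != k -> e * (c j 0 + c k 0) <= b j 0 + b k 0) ->
  i != l -> e * - qform b c <= 4 * b i 0 ^+ 2.
Proof.
move=> cb cc tl e0 H il.
have [j [k [[ij ik jk] [jl kl] S]]] := ord4_split il.
have := approx_bound (x := b i 0) (y := b j 0) (z := b k 0)
  (x' := c i 0) (y' := c j 0) (z' := c k 0) (t' := c l 0) e0.
have := cb.1; have := cc.1; rewrite /qform !S; rewrite !S in tl => qc qb hyp.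
apply: le_trans (hyp _ _ _ _ _ _ _ _); try exact: cone_pair_ge0; try exact: H.
- have -> : b l 0 = b i 0 + b j 0 + b k 0 by lra.
  by rewrite le_eqVlt; apply/orP; left; apply/eqP; field.
- have bl : b l 0 = b i 0 + b j 0 + b k 0 by lra.
  by move: qb; rewrite bl; nra.
- lra.
Qed.

(** The last hypothesis ranges over the whole group, so it survives moving [b] and [c] by the same
    reflection. Each move lowers the sum by at least [4 * d]; [n] counts the moves left. *)
Lemma cone_descent b c l (e d : R) n : cone b -> cone c ->
  2 * b l 0 = \sum_k b k 0 -> 0 < e -> 0 < d -> 4 * d ^+ 2 <= e * - qform b c ->
  (forall U i j, in_Aperp U -> i != j ->
    e * ((U *m c) i 0 + (U *m c) j 0) <= (U *m b) i 0 + (U *m b) j 0) ->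
  ~ \sum_k b k 0 < n%:R * (4 * d).
Proof.
elim: n b c => [|n IH] b c cb cc tl e0 d0 hd H; first by have := cb.2; lra.
move=> hn; have large i : i != l -> d ^+ 2 <= b i 0 ^+ 2.
  move=> il; have := cone_approx_bound cb cc tl e0 _ il.
  suff Hbc j k : j != k -> e * (c j 0 + c k 0) <= b j 0 + b k 0.
    by move/(_ Hbc) => ?; lra.
  by have := H _ j k (Aperp_one R); rewrite !mul1mx.
(* Nullity makes the pairwise products of the three entries other than [b l 0] sum to zero; nonzero
   by [large], these entries are not all positive. *)
have [i il bi] : exists2 i, i != l & b i 0 < 0.
  apply: contrapT => nn.
  have pos i : i != l -> 0 < b i 0.
    move=> il; have b0 : 0 <= b i 0.
      by rewrite leNgt; apply/negP => bi; apply: nn; exists i.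
    rewrite lt_neqAle b0 andbT eq_sym; apply/eqP => bi.
    by have := large i il; rewrite bi expr0n /=; have := exprn_gt0 2 d0; lra.
  have [i li] := ord4_neq l; rewrite eq_sym in li.
  have [j [k [_ [jl kl] S]]] := ord4_split li.
  have := cb.1; rewrite /qform !S; rewrite !S in tl.
  have -> : b l 0 = b i 0 + b j 0 + b k 0 by lra.
  have := mulr_gt0 (pos i li) (pos j jl); have := mulr_gt0 (pos i li) (pos k kl).
  have := mulr_gt0 (pos k kl) (pos j jl); lra.
have {large} bd : b i 0 <= - d.
  have : `|d| <= `|b i 0| by rewrite -ler_sqr ?nnegrE // !real_normK ?num_real ?large.
  by rewrite (gtr0_norm d0) (ltr0_norm bi); lra.
apply: (IH (Sperp R i *m b) (Sperp R i *m c)) => //; try exact: cone_Sperp.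
- by rewrite sum_Sperp SperpE eq_sym (negbTE il); lra.
- by rewrite qform_Sperp.
- move=> U j k HU jk; rewrite !mulmxA.
  by apply: H jk; exact: in_AperpM HU (in_Aperp_Sperp i).
- by rewrite sum_Sperp; move: hn; rewrite -natr1; lra.
Qed.

Lemma cone_approx b c l (e : R) : cone b -> cone c -> qform b c < 0 ->
  2 * b l 0 = \sum_k b k 0 -> 0 < e ->
  exists U i j, [/\ in_Aperp U, i != j &
    (U *m b) i 0 + (U *m b) j 0 < e * ((U *m c) i 0 + (U *m c) j 0)].
Proof.
move=> cb cc bc tl e0; apply: contrapT => no.
have eK0 : 0 < e * - qform b c by rewrite mulr_gt0 ?oppr_gt0.
pose d := Num.sqrt (e * - qform b c) / 2.
have d0 : 0 < d by rewrite divr_gt0 ?sqrtr_gt0.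
have d2 : 4 * d ^+ 2 = e * - qform b c.
  by rewrite /d exprMn sqr_sqrtr ?ltW // exprVn; field.
have d4 : 0 < 4 * d by lra.
have := archi_boundP (divr_ge0 cb.2 (ltW d4)); rewrite ltr_pdivrMr //.
apply: (cone_descent cb cc tl e0 d0); first by rewrite d2.
move=> U i j HU ij; rewrite leNgt; apply/negP => lt.
by apply: no; exists U, i, j.
Qed.

(** * Ping-pong on reduced words *)

(* U is a reduced word up to a final letter S_i, which fixes b since b_i = 0:
   every further letter h is applied where the current entry is positive, and
   leaves the entry h as the only negative one. *)
Inductive reduced i b : 'M[R]_4 -> Prop :=
| reduced_one : reduced i b 1%:M
| reduced_fix : reduced i b (Sperp R i)
| reduced_Sperp h U : reduced i b U -> 0 < (U *m b) h 0 -> reduced i b (Sperp R h *m U).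

Lemma reduced_in_Aperp i b U : reduced i b U -> in_Aperp U.
Proof.
elim=> [||h V _ HV _]; first by constructor.
  exact: in_Aperp_Sperp.
by constructor.
Qed.

(** The new entry is [(b k 0 + b h 0) + b h 0], a nonnegative pair sum plus a positive entry. *)
Lemma Sperp_gt0 b k h : cone b -> 0 < b h 0 -> k != h -> 0 < (Sperp R h *m b) k 0.
Proof.
move=> cb bh kh; rewrite SperpE (negbTE kh).
by have := cone_pair_ge0 cb kh; lra.
Qed.

(** Apart from the fixing letter [i], a repeated letter cancels and a different one meets a positive
    entry. *)
Lemma reducedS i b k U : cone b -> b i 0 = 0 ->
  (forall j, j != i -> 0 < b j 0) -> reduced i b U -> reduced i b (Sperp R k *m U).
Proof.
move=> cb bi bk; case=> [||h V rV hV].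
- have [->|ki] := eqVneq k i; first by rewrite mulmx1; constructor.
  by apply: reduced_Sperp; [constructor | rewrite mul1mx bk].
- have [->|ki] := eqVneq k i; first by rewrite Sperp_sq; constructor.
  apply: reduced_Sperp; first by constructor.
  by rewrite SperpE (negbTE ki) bi mulr0 addr0 bk.
- have [->|kh] := eqVneq k h; first by rewrite SperpK.
  apply: reduced_Sperp; first exact: reduced_Sperp.
  rewrite -mulmxA Sperp_gt0 //.
  exact: cone_Aperp (reduced_in_Aperp rV) cb.
Qed.

Lemma in_Aperp_reduced i b U : cone b -> b i 0 = 0 ->
  (forall k, k != i -> 0 < b k 0) -> in_Aperp U -> reduced i b U.
Proof.
move=> cb bi bk HU; move: U HU; apply: in_Aperp_gen_ind; first by constructor.
by move=> k U _; apply: reducedS.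
Qed.

(** After a letter [h] added by [reduced_Sperp], entry [h] is negative and the others positive; only
    the identity and [Sperp R i] leave a zero. *)
Lemma orbit_zero i j b U : cone b -> b i 0 = 0 ->
  (forall k, k != i -> 0 < b k 0) -> in_Aperp U -> (U *m b) j 0 = 0 ->
  row j U = row i 1%:M \/ row j U = - row i 1%:M.
Proof.
move=> cb bi bk HU; case: (in_Aperp_reduced cb bi bk HU) => [||h V rV hV].
- rewrite mul1mx; have [->|/bk] := eqVneq j i; first by left.
  by move=> + b0; rewrite b0 ltxx.
- rewrite SperpE; have [-> _|/bk b0] := eqVneq j i; last first.
    by rewrite bi mulr0 addr0 => bj; rewrite bj ltxx in b0.
  by right; apply/rowP => m; rewrite !mxE; move: i m {cb bi bk HU};
    apply: ord4P; apply: ord4P => /=; lra.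
- rewrite -mulmxA; have cV := cone_Aperp (reduced_in_Aperp rV) cb.
  have [->|jh] := eqVneq j h; first by rewrite SperpE eqxx => ?; exfalso; lra.
  by have := Sperp_gt0 cV hV jh; move=> + b0; rewrite b0 ltxx.
Qed.

(** * Points as null vectors *)

(** For a finite point, the row of a circle times this vector is half the curvature times the power
    of the point. *)
Definition point_vec p : 'cV[R]_4 :=
  match p with
  | Some (x, y) => \col_k nth 0 [:: 2^-1; (x ^+ 2 + y ^+ 2) / 2; - x; - y] k
  | None => \col_k (k == 1)%:R
  end.

Lemma on_circleE w p : bform w w = 1 -> on_circle w p <-> (w *m point_vec p) 0 0 = 0.
Proof.
rewrite /bform mxE sum4 => ww.
case: p => [[x y]|] /=; rewrite !mxE /=; last by split; lra.
case: eqVneq => [w0|w0] /=; first by rewrite w0; split; lra.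
have -> : (x - w 0 2 / w 0 1) ^+ 2 + (y - w 0 3 / w 0 1) ^+ 2 =
    2 / w 0 1 * (w 0 0 * 2^-1 + w 0 1 * ((x ^+ 2 + y ^+ 2) / 2) + w 0 2 * - x + w 0 3 * - y) +
    (w 0 2 * w 0 2 + w 0 3 * w 0 3 - w 0 0 * w 0 1) / w 0 1 ^+ 2 by field.
have -> : w 0 2 * w 0 2 + w 0 3 * w 0 3 - w 0 0 * w 0 1 = 1 by lra.
rewrite exprVn div1r; set z := w 0 0 * _ + _ + _ + _.
split=> [|->]; last by rewrite mulr0 add0r.
move=> h; have /eqP : 2 / w 0 1 * z = 0 by lra.
by rewrite !mulf_eq0 invr_eq0 (negbTE w0) pnatr_eq0 /= => /eqP.
Qed.

Lemma point_vec_null p : ((point_vec p)^T *m QW R *m point_vec p) 0 0 = 0.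
Proof.
rewrite !mxE sum4 !mxE !sum4 !mxE.
by case: p => [[x y]|] /=; rewrite !mxE /=; field.
Qed.

(** A nonzero null row is, up to scale, a circle of radius zero; this is its center. *)
Definition null_point w : hpoint R :=
  if w 0 1 == 0 then None else Some (w 0 2 / w 0 1, w 0 3 / w 0 1).

Lemma point_vec_null_point v : bform v v = 0 -> v != 0 ->
  exists2 t, t != 0 & forall w, (w *m point_vec (null_point v)) 0 0 = t * bform w v.
Proof.
rewrite /null_point /bform => vv v0.
have {}vv : v 0 2 ^+ 2 + v 0 3 ^+ 2 = v 0 0 * v 0 1 by lra.
case: eqVneq => [v1|v1]; last first.
  exists (- (v 0 1)^-1); first by rewrite oppr_eq0 invr_eq0.
  move=> w; rewrite !mxE sum4 !mxE /= !expr_div_n -mulrDl vv; field.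
  exact: v1.
have v2 : v 0 2 = 0 by have := sqr_ge0 (v 0 2); have := sqr_ge0 (v 0 3); nra.
have v3 : v 0 3 = 0 by have := sqr_ge0 (v 0 2); have := sqr_ge0 (v 0 3); nra.
have v00 : v 0 0 != 0.
  apply: contra v0 => /eqP v00; apply/eqP/rowP => k; rewrite mxE; move: k.
  exact: ord4P.
exists (- 2 / v 0 0); first by rewrite mulf_neq0 ?invr_eq0 // oppr_eq0 pnatr_eq0.
move=> w; rewrite !mxE sum4 !mxE /= v1 v2 v3; field.
exact: v00.
Qed.

(** * Gram matrices and dual configurations *)

(** Inverting the square matrices in [is_descartes] yields [W *m QI *m W^T = 2 *: QD R]. *)
Lemma gramE W i j : is_descartes W -> bform (row i W) (row j W) = 2 * (i == j)%:R - 1.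
Proof.
move=> dW.
have : W^T *m (2^-1 *: (QD R *m W *m QI)) = 1%:M.
  rewrite -scalemxAr !mulmxA dW QW_QI -scalemx1 scalerA mulVf ?scale1r //.
  by rewrite pnatr_eq0.
move/mulmx1C; rewrite -scalemxAl => h.
have {}h : W *m QI *m W^T = 2 *: QD R.
  rewrite -[LHS]mul1mx -QD_mul -[in RHS](mulmx1 (QD R)) -h -!scalemxAr scalerA.
  by rewrite divff ?pnatr_eq0 // scale1r !mulmxA.
have := congr1 (fun M : 'M[R]_4 => M i j) h.
rewrite bformE tr_row -!row_mul !mxE.
under [in X in _ -> X]eq_bigr do rewrite [col _ _ _ _]mxE.
by move->; field.
Qed.

Lemma bformDl u v w : bform (u + v) w = bform u w + bform v w.
Proof. by rewrite /bform !mxE; field. Qed.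

Lemma bformDr u v w : bform w (u + v) = bform w u + bform w v.
Proof. by rewrite /bform !mxE; field. Qed.

Lemma bformZl (a : R) u v : bform (a *: u) v = a * bform u v.
Proof. by rewrite /bform !mxE; field. Qed.

Lemma bformC u v : bform u v = bform v u.
Proof. by rewrite /bform; field. Qed.

Lemma bformZr (a : R) u v : bform u (a *: v) = a * bform u v.
Proof. by rewrite !(bformC u) bformZl. Qed.

Lemma Sperp_descartes i : (Sperp R i)^T *m QD R *m Sperp R i = QD R.
Proof.
apply/matrixP => j k; rewrite !mxE sum4 !mxE !sum4 !mxE; move: i j k.
by apply: ord4P; apply: ord4P; apply: ord4P => /=; field.
Qed.

Lemma Aperp_descartes U W : in_Aperp U -> is_descartes W -> is_descartes (U *m W).
Proof.
move=> HU dW; move: U HU; apply: in_Aperp_gen_ind; first by rewrite mul1mx.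
move=> i U _; rewrite /is_descartes => IH.
rewrite -(mulmxA _ U W); move: (U *m W) IH => X <-; rewrite -[in RHS](Sperp_descartes i).
by rewrite trmx_mul !mulmxA.
Qed.

Lemma DmatE : Dmat R = - QD R.
Proof.
by apply/matrixP => i j; rewrite !mxE; case: (i == j); rewrite /=; field.
Qed.

Lemma trQD : (QD R)^T = QD R.
Proof. by apply/matrixP => i j; rewrite !mxE eq_sym. Qed.

Lemma Dmat_descartes W : is_descartes W -> is_descartes (Dmat R *m W).
Proof.
rewrite /is_descartes DmatE => dW.
have -> : (- QD R *m W)^T = - (W^T *m QD R) by rewrite trmx_mul linearN /= trQD mulmxN.
by rewrite !mulNmx mulmxN opprK -!mulmxA (mulmxA (QD R) (QD R)) QD_mul mul1mx mulmxA.
Qed.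

Lemma DmatmE n (A : 'M[R]_(4, n)) i j :
  (Dmat R *m A) i j = (\sum_k A k j) / 2 - A i j.
Proof.
rewrite mxE !sum4 !mxE; move: i.
by apply: ord4P => /=; field.
Qed.

Lemma row_entry m n (A : 'M[R]_(m, n)) i k : row i A 0 k = A i k.
Proof. by rewrite mxE. Qed.

Lemma col_entry m n (A : 'M[R]_(m, n)) i k : col i A k 0 = A k i.
Proof. by rewrite mxE. Qed.

Lemma scalemx_entry m n a (A : 'M[R]_(m, n)) i k : (a *: A) i k = a * A i k.
Proof. by rewrite mxE. Qed.

(** The sum of the rows gains four times row [i] of [W]. This leaves the dual rows other than [i]
    fixed and adds the same vector, nonzero as row [i] has norm 1, to dual row [i]. *)
Lemma replace_step_Sperp W i : is_descartes W ->
  replace_step (Dmat R *m W) (Dmat R *m (Sperp R i *m W)).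
Proof.
move=> dW; split.
  exact/Dmat_descartes/Aperp_descartes/dW/in_Aperp_Sperp.
have S k : \sum_j (Sperp R i *m W) j k = \sum_j W j k + 4 * W i k.
  by rewrite !sum4 !SperpE; move: i; apply: ord4P => /=; ring.
exists i; split=> [|j ji]; last first.
  by apply/rowP => k; rewrite !row_entry !DmatmE S SperpE (negbTE ji); field.
apply/eqP => /rowP e.
have : row i W = 0.
  by apply/rowP => k; rewrite row_entry mxE; have := e k;
    rewrite !row_entry !DmatmE S SperpE eqxx; lra.
move=> w0; have := gramE i i dW; rewrite w0 eqxx mulr1 /bform !mxE; lra.
Qed.

Lemma Dmat_reach U W : in_Aperp U -> is_descartes W ->
  apollo_reach (Dmat R *m W) (Dmat R *m (U *m W)).
Proof.
move=> HU dW; move: U HU; apply: in_Aperp_gen_ind; first by rewrite mul1mx; constructor.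
move=> i U HU r; rewrite -mulmxA; apply: apollo_step r _.
exact/replace_step_Sperp/Aperp_descartes.
Qed.

Lemma bform_nondegenerate V u : is_descartes V ->
  (forall i, bform u (row i V) = 0) -> u = 0.
Proof.
move=> dV h.
have uV : u *m QI *m V^T = 0.
  by apply/rowP => i; rewrite [RHS]mxE -(h i) bformE [LHS]mxE [RHS]mxE;
    apply: eq_bigr => k _; rewrite !mxE.
have : u *m QI *m QW R = 0 by rewrite -dV !mulmxA uV !mul0mx.
have -> : u *m QI *m QW R = 2 *: u; last first.
  by move/(congr1 ( *:%R 2^-1)); rewrite scalerA mulVf ?pnatr_eq0 // scale1r scaler0.
rewrite -mulmxA; have -> : QI *m QW R = 2%:M; last by rewrite mul_mx_scalar.
apply/matrixP=> i j; rewrite !mxE sum4 !mxE; move: i j.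
by apply: ord4P; apply: ord4P => /=; field.
Qed.

Lemma bform_Dmat W i j : is_descartes W ->
  bform (row i W) (row j (Dmat R *m W)) = - 2 * (i == j)%:R.
Proof.
move=> dW.
have -> : row j (Dmat R *m W) =
    2^-1 *: (row 0 W + row 1 W + row 2 W + row 3 W) + (-1) *: row j W.
  by apply/rowP => k; rewrite !row_entry DmatmE sum4 !mxE; field.
rewrite !bformDr !bformZr !bformDr !gramE //.
move: i j; by apply: ord4P; apply: ord4P => /=; field.
Qed.

(** The change of row [i] is orthogonal to the three dual rows that stay, hence a multiple [t] of
    row [i] of [W]; norm 1 leaves [t = 0], which is excluded, or [t = 4]. *)
Lemma replace_step_inv W V : is_descartes W -> replace_step (Dmat R *m W) V ->
  exists i, V = Dmat R *m (Sperp R i *m W).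
Proof.
move=> dW [dV [i [/eqP vi vj]]]; exists i.
have dDW := Dmat_descartes dW.
set v := row i (Dmat R *m W) in vi *; set w := row i W; set v' := row i V in vi *.
have wv : bform w v = -2 by rewrite bform_Dmat // eqxx mulr1.
have vv : bform v v = 1 by rewrite gramE // eqxx mulr1; lra.
have vv' : bform v' v' = 1 by rewrite gramE // eqxx mulr1; lra.
have ww : bform w w = 1 by rewrite gramE // eqxx mulr1; lra.
pose t := bform (v' + (-1) *: v) v / -2.
have : v' + (-1) *: v + (- t) *: w = 0.
  apply: (bform_nondegenerate dDW) => j; rewrite !bformDl !bformZl.
  have [->|ji] := eqVneq j i.
    by rewrite -/v wv /t bformDl bformZl; field.
  have -> : bform v' (row j (Dmat R *m W)) = -1.
    by rewrite -(vj j ji) gramE // eq_sym (negbTE ji) mulr0; lra.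
  rewrite bform_Dmat // gramE // eq_sym (negbTE ji) !mulr0; lra.
move=> e; have {}e : v' = v + t *: w.
  by apply/rowP => k; move/rowP/(_ k): e; rewrite !mxE; lra.
have t4 : t = 4.
  move: vv'; rewrite e !bformDl !bformDr !bformZl !bformZr (bformC v w) wv vv ww.
  move=> /eqP h; have /eqP : t * (t - 4) = 0 by move/eqP: h; lra.
  rewrite mulf_eq0 => /orP[] /eqP; last by lra.
  by move=> t0; case: vi; rewrite e t0 scale0r addr0.
have S k : \sum_j (Sperp R i *m W) j k = \sum_j W j k + 4 * W i k.
  by rewrite !sum4 !SperpE; move: (i); apply: ord4P => /=; ring.
apply/row_matrixP => j; have [->|ji] := eqVneq j i.
  rewrite -/v' e t4; apply/rowP => k.
  by rewrite [LHS]mxE [X in _ + X]mxE !row_entry !DmatmE S SperpE eqxx; field.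
rewrite vj //; apply/rowP => k.
by rewrite !row_entry !DmatmE S SperpE (negbTE ji); field.
Qed.

Lemma reach_Dmat W V : is_descartes W -> apollo_reach (Dmat R *m W) V ->
  exists2 U, in_Aperp U & V = Dmat R *m (U *m W).
Proof.
move=> dW; elim=> [|V1 V2 _ [U HU ->]].
  by exists 1%:M; [constructor | rewrite mul1mx].
move/(replace_step_inv (Aperp_descartes HU dW)) => [i ->].
by exists (Sperp R i *m U); [exact: Aperp_mul | rewrite -!mulmxA].
Qed.

(** * Coordinates of points relative to a configuration *)

Lemma qform_point_vec W p q : is_descartes W ->
  qform (W *m point_vec p) (W *m point_vec q) = ((point_vec p)^T *m QW R *m point_vec q) 0 0.
Proof. by move=> dW; rewrite qformE trmx_mul -dW !mulmxA. Qed.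

Lemma on_circle_row W i p : is_descartes W ->
  on_circle (row i W) p <-> (W *m point_vec p) i 0 = 0.
Proof.
move=> dW; rewrite on_circleE -?row_mul ?row_entry //.
by rewrite gramE // eqxx mulr1; lra.
Qed.

Lemma qformZ (a : R) b c : qform (a *: b) (a *: c) = a ^+ 2 * qform b c.
Proof. by rewrite /qform !sum4 !mxE; field. Qed.

Definition colsum W k := \sum_i W i k.

(** The rows have norm 1 and mutual products -1, so their sum has norm [4 - 12]. *)
Lemma colsum_descartes W : is_descartes W ->
  colsum W 2 ^+ 2 + colsum W 3 ^+ 2 - colsum W 0 * colsum W 1 = - 8.
Proof.
move=> dW; have g i j := gramE i j dW; rewrite /colsum !sum4.
have := g 0 0; have := g 1 1; have := g 2 2; have := g 3 3; have := g 0 1.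
have := g 0 2; have := g 0 3; have := g 1 2; have := g 1 3; have := g 2 3.
rewrite /bform /= !row_entry ?mulr1 ?mulr0 => *.
lra.
Qed.

(* Descartes matrices have either sign; the factor colsum W 1 puts the null
   vectors of all points in the same half of the cone. *)
Definition pcoords W p : 'cV[R]_4 := colsum W 1 *: (W *m point_vec p).

Lemma sum_pcoords W p : \sum_i pcoords W p i 0 =
  colsum W 1 * (colsum W 0 * point_vec p 0 0 + colsum W 1 * point_vec p 1 0 +
    colsum W 2 * point_vec p 2 0 + colsum W 3 * point_vec p 3 0).
Proof. by rewrite /pcoords /colsum !sum4 !mxE !sum4; ring. Qed.

Lemma cone_pcoords W p : is_descartes W -> cone (pcoords W p).
Proof.
move=> dW; split; first by rewrite qformZ qform_point_vec // point_vec_null mulr0.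
have := colsum_descartes dW; rewrite sum_pcoords.
move: (colsum W 0) (colsum W 1) (colsum W 2) (colsum W 3) => s0 s1 s2 s3 h.
case: p => [[x y]|]; rewrite /point_vec !mxE /=; last by have := sqr_ge0 s1; lra.
(* Twice the sum is [(s1 * x - s2) ^+ 2 + (s1 * y - s3) ^+ 2 + 8]. *)
by have := sqr_ge0 (s1 * x - s2); have := sqr_ge0 (s1 * y - s3); nra.
Qed.

Lemma qform_col W i j : is_descartes W -> qform (col i W) (col j W) = QW R i j.
Proof. by move=> dW; rewrite -dW qformE !mxE !sum4 !mxE !sum4 !mxE. Qed.

Lemma mulmx_col (U W : 'M[R]_4) i : U *m col i W = col i (U *m W).
Proof. by apply/colP => k; rewrite !mxE; apply: eq_bigr => j _; rewrite mxE. Qed.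

Lemma mul_point_vec_None W : W *m point_vec None = col 1 W.
Proof. by apply/colP => i; rewrite !mxE sum4 !mxE /=; ring. Qed.

Lemma colsum1_neq0 W : is_descartes W -> colsum W 1 != 0.
Proof.
move=> /colsum_descartes s; apply/eqP => s0; move: s; rewrite s0.
by have := sqr_ge0 (colsum W 2); have := sqr_ge0 (colsum W 3); lra.
Qed.

(** Column 0 is twice the vector of the origin, the reference for approach to infinity. *)
Lemma cone_scaled_col0 W : is_descartes W -> cone (colsum W 1 *: col 0 W).
Proof.
move=> dW; have s := colsum_descartes dW; split; last first.
  have -> : \sum_i (colsum W 1 *: col 0 W) i 0 = colsum W 1 * colsum W 0.
    by rewrite /colsum !sum4 !mxE; ring.
  by have := sqr_ge0 (colsum W 2); have := sqr_ge0 (colsum W 3); lra.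
by rewrite qformZ qform_col // mxE /= mulr0.
Qed.

(** * Tangency points *)

Lemma bform_tangency W i j k : is_descartes W ->
  bform (row k W) (row i W + row j W) = 2 * (k == i)%:R + 2 * (k == j)%:R - 2.
Proof. by move=> dW; rewrite bformDr !gramE //; ring. Qed.

Lemma tangency_null W i j : is_descartes W -> i != j ->
  bform (row i W + row j W) (row i W + row j W) = 0.
Proof.
move=> dW ij; rewrite bformDl !bform_tangency // !eqxx (eq_sym j i) (negbTE ij).
by rewrite mulr1 mulr0; lra.
Qed.

Lemma on_circle_tangency W i j k : is_descartes W -> i != j ->
  on_circle (row k W) (null_point (row i W + row j W)) <-> (k == i) || (k == j).
Proof.
move=> dW ij; set n := row i W + row j W.
have nk m : bform (row m W) n = _ := bform_tangency i j m dW.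
have nn : bform n n = 0 by exact: tangency_null.
have [l [_ [[il _ _] [lj _] _]]] := ord4_split ij.
have n0 : n != 0.
  apply/eqP => n0; have := nk l; rewrite (eq_sym l i) (negbTE il) (negbTE lj) !mulr0.
  by rewrite n0 /bform !mxE; lra.
have [t t0 ht] := point_vec_null_point nn n0.
rewrite on_circle_row // -row_entry row_mul ht nk.
have [->|ki] := eqVneq k i; first by rewrite (negbTE ij) mulr0 mulr1; split=> // _; ring.
have [_|kj] := eqVneq k j; first by rewrite mulr0 mulr1; split=> // _; ring.
split=> //= /eqP; rewrite !mulr0 mulf_eq0 (negbTE t0) /= => /eqP; lra.
Qed.

Lemma tangency_Sigma W0 U i j : is_descartes W0 -> in_Aperp U -> i != j ->
  Sigma W0 (null_point (row i (U *m W0) + row j (U *m W0))).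
Proof.
move=> dW HU ij; have dUW := Aperp_descartes HU dW.
exists (row i (U *m W0)), (row j (U *m W0)).
split; first by exists U, i.
split; first by exists U, j.
split; first by apply/(on_circle_tangency _ dUW ij); rewrite eqxx.
split; first by apply/(on_circle_tangency _ dUW ij); rewrite eqxx orbT.
(* The circles differ: the tangency point of [i] with a third circle [k] is not on [j]. *)
have [k [_ [[ik _ _] [kj _] _]]] := ord4_split ij.
move=> e; have : on_circle (row i (U *m W0)) (null_point (row i (U *m W0) + row k (U *m W0))).
  by apply/(on_circle_tangency _ dUW ik); rewrite eqxx.
rewrite e => /(on_circle_tangency _ dUW ik).
by rewrite eq_sym (negbTE ij) eq_sym (negbTE kj).
Qed.

Lemma Sigma_packing W0 p : is_descartes W0 -> Sigma W0 p ->
  exists w, packing_circle (Dmat R *m W0) w /\ on_circle w p.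
Proof.
move=> dW [w1 [w2 [[U1 [i [HU1 ->]]] [[U2 [j [HU2 ->]]]]]]] [on1 [on2 ne]].
have [V HV VU] := in_AperpV HU1.
set b := U1 *m pcoords W0 p.
have cb : cone b by exact/cone_Aperp/cone_pcoords.
have bE U k : in_Aperp U -> on_circle (row k (U *m W0)) p <-> (U *m pcoords W0 p) k 0 = 0.
  move=> HU; rewrite on_circle_row; last exact: Aperp_descartes.
  rewrite -mulmxA -scalemxAr !mxE.
  split=> [->|/eqP]; first by rewrite mulr0.
  by rewrite mulf_eq0 (negbTE (colsum1_neq0 dW)) /= => /eqP.
have bi : b i 0 = 0 by apply/bE.
have [k ki bk] : exists2 k, k != i & b k 0 = 0.
  apply: contrapT => no.
  have bpos k : k != i -> 0 < b k 0.
    move=> ki; have := cone_pair_ge0 cb ki; rewrite bi addr0 le_eqVlt => /orP[/eqP bk|//].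
    by case: no; exists k.
  have : (U2 *m V *m b) j 0 = 0.
    by rewrite /b !mulmxA -(mulmxA _ V) VU mulmx1; apply/bE.
  move/(orbit_zero cb bi bpos (in_AperpM HU2 HV)).
  have U2E : U2 *m W0 = U2 *m V *m (U1 *m W0) by rewrite !mulmxA -(mulmxA _ V) VU mulmx1.
  have d1 := Aperp_descartes HU1 dW.
  move: ne; rewrite U2E (row_mul j) => ne [] e; apply: ne; rewrite e.
    by rewrite -row_mul mul1mx.
  rewrite mulNmx -row_mul mul1mx; apply/funext => q; apply/propext.
  have g : bform (row i (U1 *m W0)) (row i (U1 *m W0)) = 1.
    by rewrite gramE // eqxx mulr1; lra.
  rewrite !on_circleE //; last by rewrite -g /bform !mxE; field.
  rewrite mulNmx; set a := row i _ *m _.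
  rewrite (_ : (- a) 0 0 = - a 0 0); last by rewrite mxE.
  split=> [->|]; first by rewrite oppr0.
  by move/eqP; rewrite oppr_eq0 => /eqP.
have [l [m [[kl km lm] [li mi] S]]] := ord4_split ki.
exists (row l (Dmat R *m (U1 *m W0))); split.
  by exists (Dmat R *m (U1 *m W0)), l; split=> //; exact: Dmat_reach.
have dUW := Aperp_descartes HU1 dW.
rewrite on_circle_row; last exact: Dmat_descartes.
rewrite -mulmxA DmatmE; have /bE := bk; rewrite -/b => /(_ HU1)/(on_circle_row _ _ dUW) Xk.
have := on1; move/(on_circle_row _ _ dUW) => Xi.
have := qform_point_vec p p dUW; rewrite point_vec_null /qform !S Xk Xi => q.
(* Two zero entries and nullity make the other two equal, which is incidence with dual row [l]. *)
have /eqP : ((U1 *m W0 *m point_vec p) l 0 - (U1 *m W0 *m point_vec p) m 0) ^+ 2 = 0 by lra.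
by rewrite sqrf_eq0 => /eqP; lra.
Qed.

(** * Closures and density *)

Lemma sqr_lt_norm (x y e : R) : 0 < e -> x ^+ 2 + y ^+ 2 < e ^+ 2 -> `|x| < e /\ `|y| < e.
Proof.
move=> e0 h; have := sqr_ge0 x; have := sqr_ge0 y => y0 x0.
split; rewrite -ltr_sqr ?nnegrE ?normr_ge0 ?(ltW e0) // real_normK ?num_real //; lra.
Qed.

Lemma hclosure_min (S T : hpoint R -> Prop) :
  (forall p, S p -> hclosure T p) -> forall p, hclosure S p -> hclosure T p.
Proof.
move=> ST [[x y] cS e e0|cS M].
  have [|x' [y' [/ST /= cT d]]] := cS (e / 2); first by rewrite divr_gt0.
  have [|x2 [y2 [Tq d']]] := cT (e / 2); first by rewrite divr_gt0.
  exists x2, y2; split=> //.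
  have := sqr_ge0 (x2 - x' - (x' - x)); have := sqr_ge0 (y2 - y' - (y' - y)); nra.
have [/ST/(_ M) //|[x [y [/ST cT hM]]]] := cS M.
right; set d := x ^+ 2 + y ^+ 2 - M ^+ 2.
have d0 : 0 < d by rewrite /d; lra.
(* Moving each coordinate by less than [d / N] lowers [x ^+ 2 + y ^+ 2] by less than [d]. *)
set N := 2 * (`|x| + `|y|) + 1.
have N0 : 0 < N by rewrite /N; have := normr_ge0 x; have := normr_ge0 y; lra.
have [|x' [y' [Tq /sqr_lt_norm h]]] := cT (d / N); first exact: divr_gt0.
exists x', y'; split=> //; have [|hx hy] := h; first exact: divr_gt0.
have e1 : `|x' - x| * N < d by rewrite -ltr_pdivlMr.
have e2 : `|y' - y| * N < d by rewrite -ltr_pdivlMr.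
have f1 : - (`|x| * `|x' - x|) <= x * (x' - x) by rewrite -normrM lerNl -normrN ler_norm.
have f2 : - (`|y| * `|y' - y|) <= y * (y' - y) by rewrite -normrM lerNl -normrN ler_norm.
have g1 : 2 * (`|x| * `|x' - x|) + 2 * (`|y| * `|y' - y|) < d.
  have x0 := normr_ge0 x; have y0 := normr_ge0 y.
  have a0 := normr_ge0 (x' - x); have b0 := normr_ge0 (y' - y).
  move: x0 y0 a0 b0 e1 e2; rewrite /N.
  move: `|x| `|y| `|x' - x| `|y' - y| => a b u v a0 b0 u0 v0 e1 e2.
  have [uv|/ltW uv] := lerP u v.
    have := ler_wpM2l a0 uv; nra.
  have := ler_wpM2l b0 uv; nra.
by have := sqr_ge0 (x' - x); have := sqr_ge0 (y' - y); rewrite /d in g1; nra.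
Qed.

(** For [v] a sum of two rows, this turns the ratio of pair sums in [cone_approx] into half a
    squared distance. *)
Lemma null_point_dist v x y : bform v v = 0 -> v 0 1 != 0 ->
  ((v 0 2 / v 0 1 - x) ^+ 2 + (v 0 3 / v 0 1 - y) ^+ 2) * v 0 1 =
  2 * (v *m point_vec (Some (x, y))) 0 0.
Proof.
rewrite /bform => vv v1.
have {}vv : v 0 0 = (v 0 2 ^+ 2 + v 0 3 ^+ 2) / v 0 1.
  by apply: (mulIf v1); rewrite divfK //; lra.
rewrite !mxE sum4 !mxE /= vv; field.
exact: v1.
Qed.

Lemma packing_hclosure_Sigma W0 w p : is_descartes W0 ->
  packing_circle (Dmat R *m W0) w -> on_circle w p -> hclosure (Sigma W0) p.
Proof.
move=> dW0 [V [l [/(reach_Dmat dW0)[U HU ->] ->]]].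
have : forall X i j, in_Aperp X -> i != j ->
    Sigma W0 (null_point (row i (X *m (U *m W0)) + row j (X *m (U *m W0)))).
  by move=> X i j HX; rewrite mulmxA; apply: tangency_Sigma dW0 (in_AperpM HX HU).
move: (U *m W0) (Aperp_descartes HU dW0) => W dW SW {dW0 HU U V w}.
rewrite on_circle_row; last exact: Dmat_descartes.
rewrite -mulmxA DmatmE => tl.
set s := colsum W 1; have s0 : 0 < s ^+ 2 by rewrite exprn_even_gt0 //= colsum1_neq0.
set b := pcoords W p; have cb : cone b by exact: cone_pcoords.
have tb : 2 * b l 0 = \sum_k b k 0.
  have -> : \sum_k b k 0 = s * \sum_k (W *m point_vec p) k 0.
    by rewrite mulr_sumr; apply: eq_bigr => k _; rewrite mxE.
  rewrite [b l 0]mxE -/s.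
  have -> : (W *m point_vec p) l 0 = (\sum_k (W *m point_vec p) k 0) / 2 by lra.
  by field.
case: p tl @b cb tb => [[x y]|] tl b cb tb.
- move=> e e0; set c := pcoords W None.
  have cc : cone c by exact: cone_pcoords.
  have bc : qform b c < 0.
    by rewrite qformZ qform_point_vec // !mxE !sum4 !mxE !sum4 !mxE /= -/s; lra.
  have [|V' [i [j [HV ij]]]] := cone_approx cb cc bc tb (e := e ^+ 2 / 2).
    by rewrite divr_gt0 ?exprn_gt0.
  have := cone_pair_ge0 (cone_Aperp HV cb) ij.
  have := SW _ _ _ HV ij.
  have := tangency_null (Aperp_descartes HV dW) ij.
  rewrite /b /c /pcoords -!scalemxAr !mulmxA mul_point_vec_None -/s.
  set W' := V' *m W; set n := row i W' + row j W' => nn Sn.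
  rewrite !scalemx_entry !col_entry -!mulrDr.
  have -> : W' i 1 + W' j 1 = n 0 1 by rewrite !mxE.
  have -> : (W' *m point_vec (Some (x, y))) i 0 + (W' *m point_vec (Some (x, y))) j 0 =
      (n *m point_vec (Some (x, y))) 0 0.
    by rewrite mulmxDl -!row_mul !mxE.
  (* The strict bound forces nonzero curvature, so the tangency point is finite. *)
  move=> ge lt; have n1 : 0 < s * n 0 1.
    have := exprn_gt0 2 e0; nra.
  have n10 : n 0 1 != 0 by apply: contraTneq n1 => ->; rewrite mulr0 ltxx.
  exists (n 0 2 / n 0 1), (n 0 3 / n 0 1); split.
    by move: Sn; rewrite /null_point (negbTE n10).
  rewrite -(ltr_pM2r n1) mulrCA; rewrite null_point_dist //; lra.
(* With the origin as reference, the ratio of pair sums is the inverse squared distance of the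
   tangency point from the origin; adding 1 to [M ^+ 2] allows [M = 0]. *)
- move=> M; set c : 'cV_4 := s *: col 0 W.
  have cc : cone c by exact: cone_scaled_col0.
  have M1 : 0 < M ^+ 2 + 1 by have := sqr_ge0 M; lra.
  have bc : qform b c < 0.
    by rewrite /b /pcoords mul_point_vec_None qformZ qform_col // mxE /= -/s; lra.
  have [|V' [i [j [HV ij]]]] := cone_approx cb cc bc tb (e := (M ^+ 2 + 1)^-1).
    by rewrite invr_gt0.
  have := cone_pair_ge0 (cone_Aperp HV cb) ij.
  have := SW _ _ _ HV ij.
  have := tangency_null (Aperp_descartes HV dW) ij.
  rewrite /b /c /pcoords mul_point_vec_None -!scalemxAr !mulmx_col -/s.
  set W' := V' *m W; set n := row i W' + row j W' => nn Sn.
  rewrite !scalemx_entry !col_entry -!mulrDr.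
  have -> : W' i 1 + W' j 1 = n 0 1 by rewrite !mxE.
  have -> : W' i 0 + W' j 0 = n 0 0 by rewrite !mxE.
  rewrite (mulrC _^-1) ltr_pdivlMr // => ge lt.
  have [n1|n1] := eqVneq (n 0 1) 0; first by left; move: Sn; rewrite /null_point n1 eqxx.
  right; exists (n 0 2 / n 0 1), (n 0 3 / n 0 1); split.
    by move: Sn; rewrite /null_point (negbTE n1).
  have sn1 : 0 < s * n 0 1.
    rewrite lt_neqAle ge andbT eq_sym mulf_neq0 //; exact: colsum1_neq0.
  have nE : n 0 0 = ((n 0 2 / n 0 1) ^+ 2 + (n 0 3 / n 0 1) ^+ 2) * n 0 1.
    apply: (mulIf n1); rewrite -mulrA -expr2 mulrDl -!exprMn !divfK //.
    by move: nn; rewrite /bform; lra.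
  by rewrite -(ltr_pM2r sn1) [ltRHS]mulrCA -nE; lra.
Qed.

End ApollonianDuality.

Theorem theorem5p3 (R : realType) (W0 : 'M[R]_4) :
  is_descartes W0 ->
  hclosure (Sigma W0) = residual_set (Dmat R *m W0).
Proof.
move=> dW; apply/funext => p; apply/propext; split.
  apply: hclosure_min => q /(Sigma_packing dW) Sq {p}.
  case: q Sq => [[x y]|] Sq; last by left.
  by move=> e e0; exists x, y; rewrite !subrr expr0n addr0 exprn_gt0.
apply: hclosure_min => q [w [pw on]].
exact: packing_hclosure_Sigma dW pw on.
Qed.
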